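(* Let $1\le k<n$, $m+1=\binom nk$, and let $\mathbf b=(b_0,b_1,\dots,b_m)\in(\mathbb Z_{\ge1})^{m+1}$ be a Plücker weight vector for $k<n$. Then there exist $a\in\{1,2,\dots,k\}$ and $W=(w_1,\dots,w_n)\in\mathbb Z^n$ such that $b_i=a+\sum_{j=1}^kw_{\lambda^i_j}$ for all $i=0,1,\dots,m$.
   Context: Let $1\le k<n$ and $m+1=\binom nk$. A Schubert symbol for $k<n$ is a sequence $\lambda=(\lambda_1<\dots<\lambda_k)$ of integers in $\{1,\dots,n\}$ (identified with its underlying set). Write $\lambda\preceq\mu$ iff $\lambda_i\le\mu_i$ for all $i$, and fix a total order $\lambda^0<\lambda^1<\dots<\lambda^m$ of all Schubert symbols refining $\preceq$; write $\lambda^i=(\lambda^i_1,\dots,\lambda^i_k)$. $\mathbf b=(b_0,\dots,b_m)\in(\mathbb Z_{\ge1})^{m+1}$ is a Plücker weight vector if for all $1\le i_1<\dots<i_{k-1}\le n$ and $1\le\ell_0<\dots<\ell_k\le n$ the sum $b_{r_j}+b_{s_j}$ takes the same value for all $j\in\{0,\dots,k\}$ with $\ell_j\notin\{i_1,\dots,i_{k-1}\}$, where $\lambda^{r_j}=\{i_1,\dots,i_{k-1},\ell_j\}$ and $\lambda^{s_j}=\{\ell_0,\dots,\ell_k\}\setminus\{\ell_j\}$. *)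

(* Defs.v *)
From mathcomp Require Import all_boot all_order all_algebra.

Set Implicit Arguments.
Unset Strict Implicit.
Unset Printing Implicit Defensive.

Import Order.TTheory GRing.Theory Num.Theory.
Local Open Scope ring_scope.

(* Indices are shifted down by one: x : 'I_n stands for x + 1 in {1, ..., n}. *)
Definition schubert_symbol (n k : nat) : Type :=
  {t : k.-tuple 'I_n | sorted ltn (map val t)}.

Definition entry (n k : nat) (s : schubert_symbol n k) (j : 'I_k) : 'I_n :=
  tnth (val s) j.

Definition support (n k : nat) (s : schubert_symbol n k) : {set 'I_n} :=
  [set x in val s].

Definition schubert_le (n k : nat) (s t : schubert_symbol n k) : Prop :=
  forall j : 'I_k, (entry s j <= entry t j)%N.

(* A total order refining schubert_le is given by the listing lam 0, lam 1,
   ..., lam m of all the symbols in increasing order. *)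
Definition schubert_enumeration (n k m : nat)
    (lam : 'I_m.+1 -> schubert_symbol n k) : Prop :=
  bijective lam /\
  (forall i j : 'I_m.+1, schubert_le (lam i) (lam j) -> (i <= j)%N).

(* The indices r and s with the prescribed supports exist and are unique when
   lam is a bijection, so quantifying over them universally or existentially
   is the same. *)
Definition plucker_weight_vector (n k m : nat)
    (lam : 'I_m.+1 -> schubert_symbol n k) (b : 'I_m.+1 -> int) : Prop :=
  (forall i : 'I_m.+1, 1 <= b i) /\
  (forall (I : schubert_symbol n k.-1) (L : schubert_symbol n k.+1)
          (j j' : 'I_k.+1) (r s r' s' : 'I_m.+1),
     entry L j \notin support I ->
     entry L j' \notin support I ->
     support (lam r) = entry L j |: support I ->
     support (lam s) = support L :\ entry L j ->
     support (lam r') = entry L j' |: support I ->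
     support (lam s') = support L :\ entry L j' ->
     b r + b s = b r' + b s').

(* Main.v *)
Require Import Defs.
From mathcomp Require Import all_boot all_order all_algebra.

Set Implicit Arguments.
Unset Strict Implicit.
Unset Printing Implicit Defensive.

Import Order.TTheory GRing.Theory Num.Theory.
Local Open Scope ring_scope.

(** Read the weight as a function f on k-subsets.  Applied to (k-1)-sets I, J
    avoiding x and y, with L = J + x + y, the Plücker condition says exactly
    that f(I + x) - f(I + y) = f(J + x) - f(J + y), so this difference depends
    on x and y only.  Fixing a base point z and letting w(x) be the difference
    for the pair (x, z), the function f(S) - \sum_(x in S) w(x) is unchanged
    when one element of S is exchanged for another, hence is a constant c.
    Euclidean division of c - 1 by k then moves c into {1, ..., k}. *)

Lemma exists_subset_card (T : finType) (A : {set T}) (k : nat) :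
  (k <= #|A|)%N -> exists2 B : {set T}, B \subset A & #|B| = k.
Proof.
rewrite -bin_gt0 -cards_draws => /card_gt0P[B].
by rewrite inE => /andP[sBA /eqP cB]; exists B.
Qed.

(** Induction on a bound [d] for the size of [S :\: S']: trading some [x] of [S :\: S'] for some [y]
    of [S' :\: S] keeps the cardinality and shrinks this difference. *)
Lemma exchange_invariant_const (T : finType) (R : Type) (k : nat)
    (g : {set T} -> R) :
  (forall (S : {set T}) x y, #|S| = k -> x \in S -> y \notin S ->
     g (y |: S :\ x) = g S) ->
  forall S S' : {set T}, #|S| = k -> #|S'| = k -> g S = g S'.
Proof.
move=> gE S S' cS cS'; move: {2}#|S :\: S'| (leqnn #|S :\: S'|) => d.
elim: d S cS => [|d IHd] S cS.
  rewrite leqn0 cards_eq0 setD_eq0 => sSS'.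
  by congr g; apply/eqP; rewrite eqEcard sSS' cS cS' leqnn.
move=> leSd; have [/eqP S0|/set0Pn[x]] := boolP (S :\: S' == set0).
  by apply: IHd => //; rewrite S0 cards0.
rewrite inE => /andP[xS' xS].
have /set0Pn[y]: S' :\: S != set0.
  rewrite setD_eq0; apply: contra xS' => sS'S.
  suff -> : S' = S by [].
  by apply/eqP; rewrite eqEcard sS'S cS cS' leqnn.
rewrite inE => /andP[yS yS'].
rewrite -(gE S x y cS xS yS); apply: IHd.
  by rewrite cardsU1 !inE (negPf yS) andbF add1n -cS [RHS](cardsD1 x) xS.
rewrite -ltnS; apply: leq_trans leSd; apply: proper_card; apply/properP; split.
  apply/subsetP => u; rewrite !inE => /andP[uS'] /orP[/eqP uy|/andP[_ ->]].
    by rewrite uy yS' in uS'.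
  by rewrite uS'.
exists x; rewrite !inE ?xS ?xS' //= eqxx orbF.
by apply: contraNneq yS => <-.
Qed.

Lemma exchange_affine (T : finType) (V : zmodType) (k : nat)
    (f : {set T} -> V) :
  (k.+1 < #|T|)%N ->
  (forall (I J : {set T}) x y, #|I| = k -> #|J| = k ->
     x \notin I -> y \notin I -> x \notin J -> y \notin J ->
     f (x |: I) - f (y |: I) = f (x |: J) - f (y |: J)) ->
  exists (c : V) (w : T -> V),
    forall S : {set T}, #|S| = k.+1 -> f S = c + \sum_(x in S) w x.
Proof.
move=> ltkT fE.
have /card_gt0P[z _] : (0 < #|T|)%N by apply: leq_trans ltkT.
(* Since [k.+2 <= #|T|], some [k]-set avoids both [x] and [z]. It supplies the value [v], and [fE]
   makes [v] independent of that choice. *)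
have /fin_all_exists[w wE] (x : T) : exists v : V, forall I : {set T},
    #|I| = k -> x \notin I -> z \notin I -> f (x |: I) - f (z |: I) = v.
  have [|I] := @exists_subset_card _ (~: [set x; z]) k.
    rewrite -(leq_add2l #|[set x; z]|) cardsC.
    by apply: leq_trans ltkT; rewrite cards2 -addn2 addnC leq_add2l; case: eqP.
  rewrite subsetC => /subsetP sI cI.
  have := sI x; have := sI z; rewrite !inE !eqxx orbT => /(_ isT) zI /(_ isT) xI.
  by exists (f (x |: I) - f (z |: I)) => J cJ xJ zJ; apply: fE.
have fw (I : {set T}) (x y : T) : #|I| = k -> x != y -> x \notin I ->
    y \notin I -> f (x |: I) - f (y |: I) = w x - w y.
  (* If [z] is outside [I], the two differences with the base point telescope. If [z] lies in [I],
     then [wE] does not apply to [I], and [z] has to be traded for [x] or [y] first. *)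
  move=> cI xy xI yI; have [zI|zI] := boolP (z \in I); last first.
    by rewrite -(wE x I) // -(wE y I) // opprB subrKA.
  pose J := I :\ z.
  have card_add u : u \notin I -> #|u |: J| = k.
    by move=> uI; rewrite cardsU1 !inE (negPf uI) andbF -cI (cardsD1 z I) zI.
  have zN u : u \notin I -> z \notin u |: J.
    by move=> uI; rewrite !inE eqxx orbF; apply: contraNneq uI => <-.
  have uN u v : u != v -> u \notin I -> u \notin v |: J.
    by move=> uv uI; rewrite !inE (negPf uv) (negPf uI) andbF.
  (* Here w x and w y are computed on J + y and J + x, and the terms
     f (J + x + y) cancel. *)
  rewrite -(wE x (y |: J)) ?card_add ?zN ?uN //.
  rewrite -(wE y (x |: J)) ?card_add ?zN ?uN 1?eq_sym //.
  rewrite -(setD1K zI) -/J (setUCA [set y] [set x]) !(setUCA [set z]).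
  by rewrite opprB [RHS]addrC subrKA.
have [|S0 _ cS0] := @exists_subset_card T setT k.+1.
  by rewrite cardsT ltnW.
exists (f S0 - \sum_(x in S0) w x), w => S cS.
apply/eqP; rewrite -subr_eq; apply/eqP.
apply: (@exchange_invariant_const _ _ k.+1
  (fun S => f S - \sum_(x in S) w x)) => // {cS}S x y cS xS yS.
have xy : x != y by apply: contraNneq yS => <-.
have cI : #|S :\ x| = k by move: cS; rewrite (cardsD1 x) xS => -[].
have xI : x \notin S :\ x by rewrite !inE eqxx.
have yI : y \notin S :\ x by rewrite !inE (negPf yS) andbF.
have fS := fw _ _ _ cI xy xI yI.
rewrite -[in RHS](setD1K xS) !big_setU1 //= !opprD !addrA; congr (_ - _).
move/eqP: fS; rewrite subr_eq => /eqP ->.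
by rewrite [RHS]addrAC [w x - _]addrC addrK addrC.
Qed.

Lemma sorted_ltn_val_enum (n : nat) (A : {set 'I_n}) :
  sorted ltn (map val (enum A)).
Proof.
apply: (@subseq_sorted _ _ ltn_trans _ (map val (enum 'I_n))).
  rewrite enumT; apply/map_subseq/filter_subseq.
by rewrite val_enum_ord iota_ltn_sorted.
Qed.

Lemma symbol_of_support (n k : nat) (A : {set 'I_n}) :
  #|A| = k -> exists s : schubert_symbol n k, Defs.support s = A.
Proof.
move=> cA; have sA : size (enum A) == k by rewrite -cardE cA.
exists (exist _ (Tuple sA) (sorted_ltn_val_enum A)).
by apply/setP => x; rewrite inE mem_enum.
Qed.

Lemma symbol_uniq (n k : nat) (s : schubert_symbol n k) : uniq (val s).
Proof.
rewrite -(map_inj_uniq val_inj).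
exact: (sorted_uniq ltn_trans ltnn (valP s)).
Qed.

(** A strictly increasing sequence is determined by its set of members. *)
Lemma support_inj (n k : nat) : injective (@Defs.support n k).
Proof.
move=> s t /setP st; apply/val_inj/val_inj/(inj_map val_inj).
apply: (irr_sorted_eq ltn_trans ltnn (valP s) (valP t)) => x.
apply/mapP/mapP => -[y ys ->]; exists y => //; move: (st y); rewrite !inE.
  by rewrite ys.
by rewrite ys => ->.
Qed.

Lemma card_support (n k : nat) (s : schubert_symbol n k) : #|Defs.support s| = k.
Proof. by rewrite cardsE (card_uniqP (symbol_uniq s)) size_tuple. Qed.

Lemma sum_support (n k : nat) (V : nmodType) (w : 'I_n -> V)
    (s : schubert_symbol n k) :
  \sum_(x in Defs.support s) w x = \sum_(j < k) w (entry s j).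
Proof.
rewrite -(big_tuple _ _ (val s) xpredT) big_uniq ?symbol_uniq //=.
by apply: eq_bigl => x; rewrite inE.
Qed.

Lemma entry_of_support (n k : nat) (s : schubert_symbol n k) (x : 'I_n) :
  x \in Defs.support s -> exists j, entry s j = x.
Proof. by rewrite inE => /tnthP[j ->]; exists j. Qed.

Theorem proposition2p9 (n k m : nat) (hk : (1 <= k < n)%N)
    (hm : m.+1 = 'C(n, k))
    (lam : 'I_m.+1 -> schubert_symbol n k) (hlam : schubert_enumeration lam)
    (b : 'I_m.+1 -> int) (hb : plucker_weight_vector lam b) :
  exists (a : nat) (w : 'I_n -> int),
    (1 <= a <= k)%N /\
    forall i : 'I_m.+1, b i = a%:Z + \sum_(j < k) w (entry (lam i) j).
Proof.
case: hlam => lam_bij _; case: hb => _ hb; case: (lam_bij) => mu lamK muK.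
(* From here on symbols have length [k.+1], so the sets [I] and [J] have size [k]. *)
case: k hk hm lam lam_bij mu lamK muK hb => [//|k] /= ltkn _ lam lam_bij mu
  lamK muK hb.
(* The default 0 is only taken on sets that support no symbol, that is, of size other than
   [k.+1]. *)
pose f (S : {set 'I_n}) : int :=
  oapp b 0 [pick i | Defs.support (lam i) == S].
have fE i : f (Defs.support (lam i)) = b i.
  rewrite /f; case: pickP => [j /eqP /support_inj /(bij_inj lam_bij) -> //|].
  by move/(_ i); rewrite eqxx.
have lamP (S : {set 'I_n}) : #|S| = k.+1 -> exists i, Defs.support (lam i) = S.
  by case/symbol_of_support => s <-; exists (mu s); rewrite muK.
have [||c [w fw]] := @exchange_affine _ int k f; first by rewrite card_ord.
  move=> I J x y cI cJ xI yI xJ yJ.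
  (* Distinctness is needed for J + x + y to have [k.+2] elements; removing [x] from it leaves J +
     y, and removing [y] leaves J + x. *)
  have [->|xy] := eqVneq x y; first by rewrite !subrr.
  have cU (A : {set 'I_n}) u : #|A| = k -> u \notin A -> #|u |: A| = k.+1.
    by move=> cA uA; rewrite cardsU1 uA cA.
  have xyJ : x \notin y |: J by rewrite !inE negb_or xy.
  have yxJ : y \notin x |: J by rewrite !inE negb_or eq_sym xy.
  have [sI sIE] := symbol_of_support cI.
  have [|sL sLE] := @symbol_of_support n k.+2 (x |: (y |: J)).
    by rewrite cardsU1 xyJ cU.
  have [j jE] : exists j, entry sL j = x.
    by apply: entry_of_support; rewrite sLE !inE eqxx.
  have [j' j'E] : exists j, entry sL j = y.
    by apply: entry_of_support; rewrite sLE !inE eqxx orbT.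
  have [r rE] := lamP _ (cU _ _ cI xI).
  have [r' r'E] := lamP _ (cU _ _ cI yI).
  have [s sE] := lamP _ (cU _ _ cJ yJ).
  have [s' s'E] := lamP _ (cU _ _ cJ xJ).
  have := hb sI sL j j' r s r' s'; rewrite jE j'E sIE sLE.
  move=> /(_ xI yI rE); rewrite sE setU1K // => /(_ erefl r'E).
  rewrite setUCA setU1K // => /(_ s'E) bE.
  rewrite -rE -r'E -sE -s'E !fE.
  by apply/eqP; rewrite subr_eq addrAC eq_sym subr_eq eq_sym bE addrC.
(* Dividing [c - 1] instead of [c] puts [r.+1] between 1 and [k.+1]. Adding [q] to every weight adds
   [q *+ k.+1] to each sum of [k.+1] weights, which makes up for the rest of [c]. *)
pose q := ((c - 1) %/ k.+1%:Z)%Z.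
pose r := `|((c - 1) %% k.+1%:Z)%Z|%N.
have rE : r%:Z = ((c - 1) %% k.+1%:Z)%Z by rewrite gez0_abs // modz_ge0.
have cE : c = r.+1%:Z + q *+ k.+1.
  have /eqP := divz_eq (c - 1) k.+1%:Z.
  rewrite -rE -/q subr_eq => /eqP ->.
  by rewrite -[q *+ _]mulr_natr natz intS -addrA addrC [_ + 1]addrC.
exists r.+1, (fun x => w x + q); split.
  by rewrite /= -ltz_nat rE ltz_pmod.
move=> i; rewrite -fE fw ?card_support // sum_support cE.
by rewrite big_split /= sumr_const card_ord -addrA [q *+ _ + _]addrC.
Qed.
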